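(* Let $p$ be a prime and let $R$ be a reduced Noetherian ring of characteristic $p>0$. Suppose that $R$ is $F$-coherent. Then for every ideal $I\subseteq R$ one has $I^{F}=I^{*}$. In particular, if $R$ is $F$-coherent, then $R$ is $F$-pure if and only if $R$ is $F$-regular.
   Context: All rings are commutative with unit. A ring is coherent if every finitely generated ideal is finitely presented. For a ring $R$ of characteristic $p>0$, the perfect closure $R^{\infty}$ is obtained by adjoining to $R_{\mathrm{red}}$ all $p^e$-th roots ($e\ge1$) of all elements of $R_{\mathrm{red}}$; equivalently it is the direct limit of $R\xrightarrow{F}R\xrightarrow{F}R\to\cdots$ with $F$ the Frobenius map. A Noetherian ring $R$ of characteristic $p>0$ is $F$-coherent if $R^{\infty}$ is coherent. Let $R^{0}$ be the complement in $R$ of the union of all minimal primes of $R$. For an ideal $I$ and $q=p^e$, $I^{[q]}$ is the ideal generated by the $q$-th powers of all elements of $I$. The tight closure $I^{*}$ of $I$ is the set of $x\in R$ for which there is $c\in R^{0}$ with $cx^{q}\in I^{[q]}$ for all $q=p^{e}\gg0$. The Frobenius closure of $I$ is $I^{F}=IR^{\infty}\cap R$ (equivalently, $x\in I^F$ if and only if $x^q\in I^{[q]}$ for all $q=p^e\gg 0$). A Noetherian ring $R$ is called $F$-pure if $I=I^{F}$ for every ideal $I$ of $R$; weakly $F$-regular if $I=I^{*}$ for every ideal $I$ of $R$; and $F$-regular if every localization of $R$ is weakly $F$-regular. *)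

(* Defs.v *)
From HB Require Import structures.
From mathcomp Require Import all_boot all_algebra.
From mathcomp Require Import boolp classical_sets.
From mathcomp Require Import zify ring.

Set Implicit Arguments.
Unset Strict Implicit.
Unset Printing Implicit Defensive.

Import GRing.Theory.
Local Open Scope ring_scope.
Local Open Scope quotient_scope.
Local Open Scope classical_set_scope.

(* Ideals are sets, not the boolean [idealr] of ring_quotient, which excludes *)
(* the unit ideal. Rings may be zero ([comPzRingType]), so that localizations *)
(* at multiplicative sets containing 0 are covered.                           *)
Section Ideals.
Variable R : comPzRingType.
Implicit Types (I P : set R) (S : set R).

Definition is_ideal I : Prop :=
  [/\ I 0, (forall x y, I x -> I y -> I (x + y))
    & (forall a x, I x -> I (a * x))].

Definition ideal_gen S : set R := smallest is_ideal S.

Definition is_prime_ideal P : Prop :=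
  [/\ is_ideal P, ~ P 1 & forall x y, P (x * y) -> P x \/ P y].

Definition is_minimal_prime P : Prop :=
  is_prime_ideal P /\ (forall Q : set R, is_prime_ideal Q -> Q `<=` P -> Q = P).

Definition off_minimal_primes : set R :=
  ~` \bigcup_(P in is_minimal_prime) P.

Definition finitely_generated I : Prop :=
  exists s : seq R, I = ideal_gen [set` s].

(* An exact sequence R^m --A--> R^n --g--> I --> 0 of row vectors. *)
Definition finitely_presented I : Prop :=
  exists (m n : nat) (A : 'M[R]_(m, n)) (g : 'cV[R]_n),
    range (fun v : 'rV[R]_n => (v *m g) 0 0) = I /\
    (forall v : 'rV[R]_n, v *m g = 0 <-> exists w : 'rV[R]_m, v = w *m A).

Definition bracket_power I (q : nat) : set R :=
  ideal_gen [set x ^+ q | x in I].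

Definition tight_closure (p : nat) I : set R :=
  [set x | exists2 c, off_minimal_primes c &
     exists e0 : nat, forall e : nat, (e0 <= e)%N ->
       bracket_power I (p ^ e) (c * x ^+ (p ^ e))].

End Ideals.

Definition reduced (R : comPzRingType) : Prop :=
  forall (x : R) (n : nat), x ^+ n = 0 -> x = 0.

Definition noetherian (R : comPzRingType) : Prop :=
  forall I : set R, is_ideal I -> finitely_generated I.

Definition coherent (R : comPzRingType) : Prop :=
  forall I : set R, finitely_generated I -> finitely_presented I.

Record mult_set (R : comPzRingType) := MultSet {
  mult_set_carrier :> set R;
  mult_set1 : mult_set_carrier 1;
  mult_setM : forall x y, mult_set_carrier x -> mult_set_carrier y ->
    mult_set_carrier (x * y) }.

Module Localization.
Section Localization.
Variables (R : comPzRingType) (S : mult_set R).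

(* (a, s) stands for the fraction a / s *)
Local Notation frac := (R * set_type S)%type.
Implicit Types (x y z : frac) (s t : set_type S).

Definition den s : R := val s.
Arguments den : simpl never.

Lemma denP s : mult_set_carrier S (den s). Proof. exact: set_valP. Qed.

Definition mkden (u : R) (Su : mult_set_carrier S u) : set_type S := exist _ u (mem_set Su).
Definition den1 : set_type S := mkden (mult_set1 S).
Definition denM s t : set_type S := mkden (mult_setM (denP s) (denP t)).

Lemma den1E : den den1 = 1. Proof. by []. Qed.
Lemma denME s t : den (denM s t) = den s * den t. Proof. by []. Qed.
Definition denE := (den1E, denME).

Definition equiv x y : bool :=
  `[< exists2 u : R, mult_set_carrier S u & u * (x.1 * den y.2) = u * (y.1 * den x.2) >].

Lemma equivP x y :
  reflect (exists2 u : R, mult_set_carrier S u & u * (x.1 * den y.2) = u * (y.1 * den x.2))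
          (equiv x y).
Proof. exact: asboolP. Qed.

Lemma equiv_refl : reflexive equiv.
Proof. by move=> x; apply/equivP; exists 1; first exact: mult_set1. Qed.

Lemma equiv_sym : symmetric equiv.
Proof. by move=> x y; apply/equivP/equivP => -[u Su e]; exists u. Qed.

Lemma equiv_trans : transitive equiv.
Proof.
move=> y x z /equivP[u Su xy] /equivP[v Sv yz]; apply/equivP.
exists (u * v * den y.2); first by do 2?apply: mult_setM => //; exact: denP.
transitivity (v * den z.2 * (u * (x.1 * den y.2))); first by ring.
rewrite xy.
transitivity (u * den x.2 * (v * (y.1 * den z.2))); first by ring.
by rewrite yz; ring.
Qed.

Canonical equiv_equiv := EquivRel equiv equiv_refl equiv_sym equiv_trans.

Definition type := {eq_quot equiv}.
HB.instance Definition _ : EqQuotient _ equiv type := EqQuotient.on type.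
HB.instance Definition _ := Choice.on type.

Lemma repr_equiv x : exists2 u : R, mult_set_carrier S u &
  u * ((repr (\pi_type x)).1 * den x.2)
    = u * (x.1 * den (repr (\pi_type x)).2).
Proof. by apply/equivP; rewrite -eqmodE reprK. Qed.

Definition zero : type := lift_cst type (0, den1).
Canonical pi_zero_morph := PiConst zero.
Definition one : type := lift_cst type (1, den1).
Canonical pi_one_morph := PiConst one.

Definition addf x y : frac :=
  (x.1 * den y.2 + y.1 * den x.2, denM x.2 y.2).
Definition add := lift_op2 type addf.
Lemma pi_add : {morph \pi : x y / addf x y >-> add x y}.
Proof.
move=> x y; unlock add; apply/eqmodP; rewrite /= equiv_sym; apply/equivP.
have [u Su ex] := repr_equiv x; have [v Sv ey] := repr_equiv y.
exists (u * v); first exact: mult_setM.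
rewrite /addf /= !denE.
move: (repr (\pi_type x)) (repr (\pi_type y)) ex ey => x' y' ex ey.
transitivity (v * den y'.2 * den y.2 * (u * (x'.1 * den x.2))
  + u * den x'.2 * den x.2 * (v * (y'.1 * den y.2))); first by ring.
by rewrite ex ey; ring.
Qed.
Canonical pi_add_morph := PiMorph2 pi_add.

Definition oppf x : frac := (- x.1, x.2).
Definition opp := lift_op1 type oppf.
Lemma pi_opp : {morph \pi : x / oppf x >-> opp x}.
Proof.
move=> x; unlock opp; apply/eqmodP; rewrite /= equiv_sym; apply/equivP.
by have [u Su ex] := repr_equiv x; exists u => //=; rewrite !(mulNr, mulrN) ex.
Qed.
Canonical pi_opp_morph := PiMorph1 pi_opp.

Definition mulf x y : frac := (x.1 * y.1, denM x.2 y.2).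
Definition mul := lift_op2 type mulf.
Lemma pi_mul : {morph \pi : x y / mulf x y >-> mul x y}.
Proof.
move=> x y; unlock mul; apply/eqmodP; rewrite /= equiv_sym; apply/equivP.
have [u Su ex] := repr_equiv x; have [v Sv ey] := repr_equiv y.
exists (u * v); first exact: mult_setM.
rewrite /mulf /= !denE.
move: (repr (\pi_type x)) (repr (\pi_type y)) ex ey => x' y' ex ey.
transitivity ((u * (x'.1 * den x.2)) * (v * (y'.1 * den y.2))).
  by ring.
by rewrite ex ey; ring.
Qed.
Canonical pi_mul_morph := PiMorph2 pi_mul.

Lemma frac_eq x y : x.1 * den y.2 = y.1 * den x.2 -> \pi_type x = \pi_type y.
Proof. by move=> e; apply/eqmodP/equivP; exists 1; [exact: mult_set1 | rewrite e]. Qed.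

Lemma addA : associative add.
Proof.
elim/quotW=> x; elim/quotW=> y; elim/quotW=> z; rewrite !piE.
by apply: frac_eq; rewrite /= ?denE; ring.
Qed.

Lemma addC : commutative add.
Proof.
by elim/quotW=> x; elim/quotW=> y; rewrite !piE; apply: frac_eq; rewrite /= ?denE; ring.
Qed.

Lemma add0 : left_id zero add.
Proof. by elim/quotW=> x; rewrite !piE; apply: frac_eq; rewrite /= ?denE; ring. Qed.

Lemma addN : left_inverse zero opp add.
Proof. by elim/quotW=> x; rewrite !piE; apply: frac_eq; rewrite /= ?denE; ring. Qed.

HB.instance Definition _ := GRing.isZmodule.Build type addA addC add0 addN.

Lemma mulA : associative mul.
Proof.
elim/quotW=> x; elim/quotW=> y; elim/quotW=> z; rewrite !piE.
by apply: frac_eq; rewrite /= ?denE; ring.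
Qed.

Lemma mulC : commutative mul.
Proof.
by elim/quotW=> x; elim/quotW=> y; rewrite !piE; apply: frac_eq; rewrite /= ?denE; ring.
Qed.

Lemma mul1 : left_id one mul.
Proof. by elim/quotW=> x; rewrite !piE; apply: frac_eq; rewrite /= ?denE; ring. Qed.

Lemma mulDl : left_distributive mul add.
Proof.
elim/quotW=> x; elim/quotW=> y; elim/quotW=> z; rewrite !piE.
by apply: frac_eq; rewrite /= ?denE; ring.
Qed.

HB.instance Definition _ :=
  GRing.Zmodule_isComPzRing.Build type mulA mulC mul1 mulDl.

Definition inj (a : R) : type := \pi_type (a, den1).

Lemma inj_is_zmod_morphism : zmod_morphism inj.
Proof.
move=> a b; rewrite /inj -[X in _ = _ + X]pi_opp -[RHS]pi_add.
by apply: frac_eq; rewrite /= ?denE; ring.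
Qed.

Lemma inj_is_monoid_morphism : monoid_morphism inj.
Proof.
split=> [|a b]; first by rewrite /inj -[RHS]/one !piE.
by rewrite /inj -[RHS]pi_mul; apply: frac_eq; rewrite /= ?denE; ring.
Qed.

HB.instance Definition _ :=
  GRing.isZmodMorphism.Build R type inj inj_is_zmod_morphism.
HB.instance Definition _ :=
  GRing.isMonoidMorphism.Build R type inj inj_is_monoid_morphism.

End Localization.
End Localization.
HB.export Localization.

Notation localization := Localization.type.

(* The direct limit of R --f--> R --f--> R --f--> ... *)
Module IterLimit.
Section IterLimit.
Variables (R : comPzRingType) (f : {rmorphism R -> R}).

(* (n, a) stands for the class of a in the n-th copy of R *)
Local Notation germ := (nat * R)%type.
Implicit Types (x y z : germ).

Definition equiv x y : bool :=
  `[< exists k : nat, iter (k + y.1) f x.2 = iter (k + x.1) f y.2 >].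

Lemma equivP x y :
  reflect (exists k : nat, iter (k + y.1) f x.2 = iter (k + x.1) f y.2)
          (equiv x y).
Proof. exact: asboolP. Qed.

Lemma equiv_refl : reflexive equiv.
Proof. by move=> x; apply/equivP; exists 0. Qed.

Lemma equiv_sym : symmetric equiv.
Proof. by move=> x y; apply/equivP/equivP => -[u e]; exists u. Qed.

Lemma equiv_trans : transitive equiv.
Proof.
move=> y x z /equivP[k xy] /equivP[l yz]; apply/equivP; exists (l + (k + y.1))%N.
by rewrite addnAC iterD xy -iterD addnC iterD yz -iterD; congr iter; lia.
Qed.

Canonical equiv_equiv := EquivRel equiv equiv_refl equiv_sym equiv_trans.

Definition type := {eq_quot equiv}.
HB.instance Definition _ : EqQuotient _ equiv type := EqQuotient.on type.
HB.instance Definition _ := Choice.on type.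

Lemma repr_equiv x : exists k : nat,
  iter (k + x.1) f (repr (\pi_type x)).2
    = iter (k + (repr (\pi_type x)).1) f x.2.
Proof. by apply/equivP; rewrite -eqmodE reprK. Qed.

Lemma iter0 n : iter n f 0 = 0.
Proof. by elim: n => //= n ->; rewrite rmorph0. Qed.
Lemma iter1 n : iter n f 1 = 1.
Proof. by elim: n => //= n ->; rewrite rmorph1. Qed.
Lemma iterN n : {morph iter n f : a / - a}.
Proof. by elim: n => [|n ih a] //=; rewrite ih rmorphN. Qed.
Lemma iterA n : {morph iter n f : a b / a + b}.
Proof. by elim: n => [|n ih a b] //=; rewrite ih rmorphD. Qed.
Lemma iterM n : {morph iter n f : a b / a * b}.
Proof. by elim: n => [|n ih a b] //=; rewrite ih rmorphM. Qed.

Lemma germ_eq x y : iter y.1 f x.2 = iter x.1 f y.2 -> \pi_type x = \pi_type y.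
Proof. by move=> e; apply/eqmodP/equivP; exists 0%N. Qed.

Definition zero : type := lift_cst type (0%N, 0).
Canonical pi_zero_morph := PiConst zero.
Definition one : type := lift_cst type (0%N, 1).
Canonical pi_one_morph := PiConst one.

Definition addf x y : germ :=
  ((x.1 + y.1)%N, iter y.1 f x.2 + iter x.1 f y.2).
Definition add := lift_op2 type addf.
Lemma pi_add : {morph \pi : x y / addf x y >-> add x y}.
Proof.
move=> x y; unlock add; apply/eqmodP; rewrite /= equiv_sym; apply/equivP.
have [k ex] := repr_equiv x; have [l ey] := repr_equiv y.
exists (k + l)%N; rewrite /addf /=.
move: (repr (\pi_type x)) (repr (\pi_type y)) ex ey => x' y' ex ey.
rewrite !iterA -!iterD; congr (_ + _).
  transitivity (iter (l + y.1 + y'.1) f (iter (k + x.1) f x'.2)).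
    by rewrite -iterD; congr iter; lia.
  by rewrite ex -iterD; congr iter; lia.
transitivity (iter (k + x.1 + x'.1) f (iter (l + y.1) f y'.2)).
  by rewrite -iterD; congr iter; lia.
by rewrite ey -iterD; congr iter; lia.
Qed.
Canonical pi_add_morph := PiMorph2 pi_add.

Definition oppf x : germ := (x.1, - x.2).
Definition opp := lift_op1 type oppf.
Lemma pi_opp : {morph \pi : x / oppf x >-> opp x}.
Proof.
move=> x; unlock opp; apply/eqmodP; rewrite /= equiv_sym; apply/equivP.
by have [k ex] := repr_equiv x; exists k; rewrite /= !iterN ex.
Qed.
Canonical pi_opp_morph := PiMorph1 pi_opp.

Definition mulf x y : germ :=
  ((x.1 + y.1)%N, iter y.1 f x.2 * iter x.1 f y.2).
Definition mul := lift_op2 type mulf.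
Lemma pi_mul : {morph \pi : x y / mulf x y >-> mul x y}.
Proof.
move=> x y; unlock mul; apply/eqmodP; rewrite /= equiv_sym; apply/equivP.
have [k ex] := repr_equiv x; have [l ey] := repr_equiv y.
exists (k + l)%N; rewrite /mulf /=.
move: (repr (\pi_type x)) (repr (\pi_type y)) ex ey => x' y' ex ey.
rewrite !iterM -!iterD; congr (_ * _).
  transitivity (iter (l + y.1 + y'.1) f (iter (k + x.1) f x'.2)).
    by rewrite -iterD; congr iter; lia.
  by rewrite ex -iterD; congr iter; lia.
transitivity (iter (k + x.1 + x'.1) f (iter (l + y.1) f y'.2)).
  by rewrite -iterD; congr iter; lia.
by rewrite ey -iterD; congr iter; lia.
Qed.
Canonical pi_mul_morph := PiMorph2 pi_mul.

Lemma addA : associative add.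
Proof.
elim/quotW=> x; elim/quotW=> y; elim/quotW=> z; rewrite !piE.
apply: germ_eq; rewrite /= !iterA -!iterD addrA.
by congr (_ + _ + _); congr iter; lia.
Qed.

Lemma addC : commutative add.
Proof.
elim/quotW=> x; elim/quotW=> y; rewrite !piE.
by apply: germ_eq; rewrite /= addnC addrC.
Qed.

Lemma add0 : left_id zero add.
Proof.
by elim/quotW=> x; rewrite !piE; apply: germ_eq; rewrite /= iter0 add0r.
Qed.

Lemma addN : left_inverse zero opp add.
Proof.
elim/quotW=> x; rewrite !piE; apply: germ_eq.
by rewrite /= -iterA addNr !iter0.
Qed.

HB.instance Definition _ := GRing.isZmodule.Build type addA addC add0 addN.

Lemma mulA : associative mul.
Proof.
elim/quotW=> x; elim/quotW=> y; elim/quotW=> z; rewrite !piE.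
apply: germ_eq; rewrite /= !iterM -!iterD mulrA.
by congr (_ * _ * _); congr iter; lia.
Qed.

Lemma mulC : commutative mul.
Proof.
elim/quotW=> x; elim/quotW=> y; rewrite !piE.
by apply: germ_eq; rewrite /= addnC mulrC.
Qed.

Lemma mul1 : left_id one mul.
Proof.
by elim/quotW=> x; rewrite !piE; apply: germ_eq; rewrite /= iter1 mul1r.
Qed.

Lemma mulDl : left_distributive mul add.
Proof.
elim/quotW=> x; elim/quotW=> y; elim/quotW=> z; rewrite !piE.
apply: germ_eq; rewrite /= !(iterA, iterM) -!iterD mulrDl.
by congr (_ * _ + _ * _); congr iter; lia.
Qed.

HB.instance Definition _ :=
  GRing.Zmodule_isComPzRing.Build type mulA mulC mul1 mulDl.

Definition inj (a : R) : type := \pi_type (0%N, a).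

Lemma inj_is_zmod_morphism : zmod_morphism inj.
Proof. by move=> a b; rewrite /inj -[X in _ = _ + X]pi_opp -[RHS]pi_add. Qed.

Lemma inj_is_monoid_morphism : monoid_morphism inj.
Proof.
by split=> [|a b]; [rewrite /inj -[RHS]/one !piE | rewrite /inj -[RHS]pi_mul].
Qed.

HB.instance Definition _ :=
  GRing.isZmodMorphism.Build R type inj inj_is_zmod_morphism.
HB.instance Definition _ :=
  GRing.isMonoidMorphism.Build R type inj inj_is_monoid_morphism.

End IterLimit.
End IterLimit.
HB.export IterLimit.

Section FrobeniusProperties.
Variables (R : comNzRingType) (p : nat) (pcharRp : p \in [pchar R]).

Definition perfect_closure : comPzRingType :=
  IterLimit.type (pFrobenius_aut pcharRp).

Definition to_perfect_closure : {rmorphism R -> perfect_closure} :=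
  IterLimit.inj (pFrobenius_aut pcharRp).

Definition F_coherent : Prop := noetherian R /\ coherent perfect_closure.

Definition frobenius_closure (I : set R) : set R :=
  to_perfect_closure @^-1` ideal_gen (to_perfect_closure @` I).

Definition F_pure : Prop :=
  noetherian R /\ (forall I : set R, is_ideal I -> frobenius_closure I = I).

End FrobeniusProperties.

(* p is a bare parameter so that these definitions apply to every localization, *)
(* including the zero ring, for which [pchar] is not defined.                   *)
Definition weakly_F_regular (p : nat) (R : comPzRingType) : Prop :=
  noetherian R /\ (forall I : set R, is_ideal I -> tight_closure p I = I).

Definition F_regular (p : nat) (R : comPzRingType) : Prop :=
  noetherian R /\ (forall S : mult_set R, weakly_F_regular p (localization S)).

(* Main.v *)
Require Import Defs.
From HB Require Import structures.
From mathcomp Require Import all_boot all_algebra.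
From mathcomp Require Import boolp classical_sets.
From mathcomp Require Import zify ring.

(** Write S for the perfect closure of R and [c^{1/q}] for the [q]-th root of
[c] in S. The inclusion of the Frobenius closure [I^F = IS \cap R] in the tight
closure is the case [c = 1]. Conversely let [c x^q \in I^[q]] for all large
[q = p^e]. Taking [q]-th roots, [c^{1/q}] lies in [J = (IS : x)] for all large
[q], and [1 \in J] has to be shown.

Coherence of S makes the colon ideal [J] finitely generated
([coherent_colon]), so finitely many [p^N]-th roots of elements of R generate
it, and [J] is controlled by an ideal [J0] of R, namely the [a] with
[a^{1/p^N} \in J] ([fg_ideal_descent]). Raising a relation for [c^{1/p^e}] to a
large power of [p] brings it down to R: for some [Q], depending on [e], one gets
[c^Q \in J0^{Q p^(e-N)}] ([extended_power]). Thus the powers of [c] lie in powers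
of [J0] at an arbitrarily large rate [p^(e-N)].

This is impossible for a proper ideal. By Artin-Rees for the principal ideal
[cR] ([artin_rees_principal]) there is [k] such that [c a \in J0^n] implies
[a \in J0^(n-k)] up to the annihilator of [c]. An element [c] outside all minimal
primes of a reduced ring is a nonzerodivisor ([off_minimal_primes_regular]), so
the [Q] factors [c] can be cancelled one at a time, each at the cost of [k]:
hence [1 \in J0^{Q (p^(e-N) - k)}], and [1 \in J0] as soon as [p^(e-N) > k].

Artin-Rees comes from Hilbert's basis theorem ([hilbert_basis]): the Rees algebra
of [J0] is an image of an iterated polynomial ring over R.

For the equivalence, F-regularity concerns every localization of R at a
multiplicative set [W]. Rather than proving that F-coherence localizes, the
argument above is carried out in R up to multiplication by elements of [W]
([frobenius_closure_of_tight]): [c] only has to be a nonzerodivisor in the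
localization. The case [W = {1}] gives [I^* = I^F], and general [W] gives
F-pure implies F-regular. For the converse, R is its own localization at [{1}],
and elements of [I^F] lie in the tight closure there. *)

Set Implicit Arguments.
Unset Strict Implicit.
Unset Printing Implicit Defensive.

Import GRing.Theory.
Local Open Scope ring_scope.
Local Open Scope quotient_scope.
Local Open Scope classical_set_scope.

(** * Ideals and their powers *)

Lemma uniform_bound (T : eqType) (s : seq T) (P : nat -> T -> Prop) :
  (forall k l x, (k <= l)%N -> P k x -> P l x) ->
  (forall x, x \in s -> exists k, P k x) -> exists k, forall x, x \in s -> P k x.
Proof.
move=> Pmono; elim: s => [|y s IH] Ps; first by exists 0%N.
have [k Pk] := Ps y (mem_head _ _).
have [|l Pl] := IH; first by move=> x xs; apply: Ps; rewrite inE xs orbT.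
exists (maxn k l) => x; rewrite inE => /predU1P[->|xs].
  by apply: Pmono Pk; rewrite leq_maxl.
by apply: Pmono (Pl _ xs); rewrite leq_maxr.
Qed.

Section IdealBasics.
Variable R : comPzRingType.
Implicit Types (I J S : set R) (x y c : R).

Lemma ideal_genP S : is_ideal (ideal_gen S).
Proof.
split=> [J [[] //]|x y Sx Sy J JS|a x Sx J JS].
  by have [[_ JD _] _] := JS; apply: JD; [exact: Sx|exact: Sy].
by have [[_ _ JM] _] := JS; apply: JM; exact: Sx.
Qed.

Lemma sub_ideal_gen S : S `<=` ideal_gen S.
Proof. exact: sub_gen_smallest. Qed.

Lemma ideal_gen_sub S I : is_ideal I -> S `<=` I -> ideal_gen S `<=` I.
Proof. exact: smallest_sub. Qed.

Lemma ideal_genS S S' : S `<=` S' -> ideal_gen S `<=` ideal_gen S'.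
Proof.
move=> SS'; apply: ideal_gen_sub; first exact: ideal_genP.
by apply: subset_trans SS' _; exact: sub_ideal_gen.
Qed.

Lemma ideal0 I : is_ideal I -> I 0. Proof. by case. Qed.

Lemma idealD I x y : is_ideal I -> I x -> I y -> I (x + y).
Proof. by case=> _ + _; exact. Qed.

Lemma idealMl I a x : is_ideal I -> I x -> I (a * x).
Proof. by case=> _ _; exact. Qed.

Lemma idealMr I x a : is_ideal I -> I x -> I (x * a).
Proof. by rewrite mulrC; exact: idealMl. Qed.

Lemma idealN I x : is_ideal I -> I x -> I (- x).
Proof. by move=> II Ix; rewrite -mulN1r; exact: idealMl. Qed.

Lemma idealB I x y : is_ideal I -> I x -> I y -> I (x - y).
Proof. by move=> II Ix Iy; apply: idealD => //; exact: idealN. Qed.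

Lemma ideal_sum I (T : Type) (r : seq T) (P : pred T) (F : T -> R) :
  is_ideal I -> (forall i, P i -> I (F i)) -> I (\sum_(i <- r | P i) F i).
Proof.
move=> II IF; apply: big_ind => //; first exact: ideal0.
by move=> x y; exact: idealD.
Qed.

Lemma ideal_gen_seqP (s : seq R) x : ideal_gen [set` s] x ->
  exists t : 'I_(size s) -> R, x = \sum_i t i * s`_i.
Proof.
move: x; apply: ideal_gen_sub.
  split=> [|x y [t ->] [u ->]|a x [t ->]].
  - by exists (fun=> 0); rewrite big1 // => i _; rewrite mul0r.
  - by exists (fun i => t i + u i); rewrite -big_split; apply: eq_bigr => i _; rewrite mulrDl.
  - by exists (fun i => a * t i); rewrite big_distrr; apply: eq_bigr => i _; rewrite /= mulrA.
move=> y /= ys; have si : (index y s < size s)%N by rewrite index_mem.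
exists (fun i => (i == Ordinal si)%:R).
rewrite (bigD1 (Ordinal si)) //= eqxx mul1r nth_index // big1 ?addr0 // => i /negPf ->.
by rewrite mul0r.
Qed.

(** The union of the chain is an ideal, and its finitely many generators already
lie in one member. *)
Lemma noetherian_chain (C : nat -> set R) : noetherian R ->
  (forall n, is_ideal (C n)) -> (forall m n, (m <= n)%N -> C m `<=` C n) ->
  exists k, forall n, C n `<=` C k.
Proof.
move=> noethR IC monoC.
have IU : is_ideal (\bigcup_n C n).
  split=> [|x y [m _ Cx] [n _ Cy]|a x [n _ Cx]].
  - by exists 0%N => //; exact: ideal0.
  - exists (maxn m n) => //.
    by apply: idealD => //; [apply: monoC Cx|apply: monoC Cy];
      rewrite ?leq_maxl ?leq_maxr.
  - by exists n => //; exact: idealMl.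
have [s Us] := noethR _ IU.
have [||k Ck] := @uniform_bound _ s (fun n x => C n x).
- by move=> m n x mn; exact: monoC.
- move=> x xs; have : (\bigcup_n C n) x by rewrite Us; exact: sub_ideal_gen.
  by case=> n _ ?; exists n.
exists k => n x Cnx.
suff : ideal_gen [set` s] `<=` C k by apply; rewrite -Us; exists n.
exact: ideal_gen_sub.
Qed.

(** The zeroth power is the unit ideal, so that for [n <= k] a membership in the
power [n - k] carries no information. *)
Fixpoint ideal_power I n : set R :=
  if n is n'.+1 then ideal_gen [set x * y | x in I & y in ideal_power I n']
  else setT.

Lemma ideal_powerP I n : is_ideal (ideal_power I n).
Proof. by case: n => [|n]; [split|exact: ideal_genP]. Qed.

Lemma ideal_powerS I n x y : I x -> ideal_power I n y -> ideal_power I n.+1 (x * y).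
Proof. by move=> Ix Iy; apply: sub_ideal_gen; exists x => //; exists y. Qed.

Lemma ideal_powerM I m n x y :
  ideal_power I m x -> ideal_power I n y -> ideal_power I (m + n) (x * y).
Proof.
elim: m x => [|m IH] x + Iy; first by move=> _; exact: (idealMl _ (ideal_powerP I n)) Iy.
rewrite addSn; move: x.
apply: (@ideal_gen_sub _ [set x | ideal_power I (m + n).+1 (x * y)]).
  have PI := ideal_powerP I (m + n).+1.
  split=> [|a b|a b] /=; rewrite ?(mul0r, mulrDl, mulrA) -?mulrA.
  - exact: ideal0.
  - exact: idealD.
  - exact: idealMl.
move=> _ [a Ia [b Ib <-]]; rewrite /= -mulrA.
by apply: ideal_powerS => //; exact: IH.
Qed.

Lemma ideal_power_le I m n : (m <= n)%N -> ideal_power I n `<=` ideal_power I m.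
Proof.
move=> /subnK <-; elim: (n - m)%N => // k IH; rewrite addSn.
apply: ideal_gen_sub; first exact: ideal_powerP.
by move=> _ [x _ [y /IH Iy <-]]; apply: idealMl => //; exact: ideal_powerP.
Qed.

Lemma ideal_power_sub I n : is_ideal I -> (0 < n)%N -> ideal_power I n `<=` I.
Proof.
move=> II /(ideal_power_le (I := I)) /subset_trans; apply.
by apply: ideal_gen_sub => // _ [x Ix [y _ <-]]; exact: idealMr.
Qed.

Lemma bracket_power_sub I q : bracket_power I q `<=` ideal_power I q.
Proof.
apply: ideal_gen_sub; first exact: ideal_powerP.
move=> _ [x Ix <-]; elim: q => // q IH.
by rewrite exprS; exact: ideal_powerS.
Qed.

End IdealBasics.

(** * Hilbert's basis theorem *)

Section Hilbert.
Variable T : comNzRingType.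

(** If I were not finitely generated, one could choose successively [f_0, f_1, ...]
in I, each of least degree outside the ideal of the previous ones. The ideals
of their leading coefficients stabilize, so the leading coefficient of some
[f_k] is a combination of the earlier ones; subtracting the corresponding
combination of shifts of earlier polynomials gives an element of smaller degree
that still lies outside, contradicting the choice of [f_k]. *)
Theorem hilbert_basis : noetherian T -> noetherian {poly T}.
Proof.
move=> noethT I II; apply: contrapT => nfg.
have step (s : seq {poly T}) : exists f, [set` s] `<=` I ->
    [/\ I f, ~ ideal_gen [set` s] f &
        forall g, I g -> ~ ideal_gen [set` s] g -> (size f <= size g)%N].
  have [sI|nsI] := pselect ([set` s] `<=` I); last by exists 0.
  pose P n := `[< exists f, [/\ I f, ~ ideal_gen [set` s] f & size f = n] >].
  have exP : exists n, P n.
    apply: contrapT => nP; apply: nfg; exists s; apply/seteqP; split => [f If|].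
      apply: contrapT => sf; apply: nP; exists (size f); apply/asboolP.
      by exists f.
    exact: ideal_gen_sub.
  have /asboolP[f [If sf szf]] := xchooseP exP.
  case: (ex_minnP exP) => n /asboolP[g [Ig sg szg]] nmin.
  exists g => _; split=> // h Ih sh; rewrite szg; apply: nmin.
  by apply/asboolP; exists h.
have {step}[next nextP] := choice step.
pose S n := iter n (fun s => next s :: s) [::].
have SI n : [set` S n] `<=` I.
  elim: n => // n IH f /=; rewrite inE => /predU1P[->|]; last exact: IH.
  by have [] := nextP _ IH.
have Smono m n : (m <= n)%N -> [set` S m] `<=` [set` S n].
  move=> /subnK <-; elim: (n - m)%N => // k IH f /IH /=.
  by rewrite inE => ->; rewrite orbT.
have Ssize n f : f \in S n -> (size f <= size (next (S n)))%N.
  move=> fS; have [m mn ->] : exists2 m, (m <= n)%N & f = next (S m).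
    elim: n fS => // n IH; rewrite inE => /predU1P[->|/IH[m mn ->]].
      by exists n.
    by exists m; rewrite // ltnW.
  have [Inext nnext _] := nextP _ (SI n).
  have [_ _] := nextP _ (SI m); apply => // nm; apply: nnext.
  by apply: ideal_genS nm; exact: Smono.
pose L n := ideal_gen (lead_coef @` [set` S n]).
have [k Lk] : exists k, forall n, L n `<=` L k.
  apply: noetherian_chain => // [n|m n mn]; first exact: ideal_genP.
  by apply: ideal_genS; apply: image_subset; exact: Smono.
pose f := next (S k); pose d := (size f).-1.
have [If nf fmin] := nextP _ (SI k).
have f0 : f != 0 by apply/eqP => f0; apply: nf; rewrite -/f f0; exact: ideal0 (ideal_genP _).
have : L k.+1 (lead_coef f).
  by apply: sub_ideal_gen; exists f => //=; rewrite inE eqxx.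
move=> /Lk lf.
have GI := ideal_genP [set` S k].
(* [S k] has members of degree at most that of [f], so shifting them by powers
   of 'X aligns their leading terms with the one of [f]. *)
have lowest a : L k a -> exists h,
    [/\ ideal_gen [set` S k] h, (size h <= size f)%N & h`_d = a].
  move: a; apply: ideal_gen_sub.
    split=> [|a b [g [Sg szg <-]] [h [Sh szh <-]]|a b [g [Sg szg <-]]].
    - by exists 0; split; [exact: ideal0|rewrite size_poly0|rewrite coef0].
    - exists (g + h); split; [exact: (idealD GI)| |by rewrite coefD].
      by rewrite (leq_trans (size_polyD _ _)) // geq_max szg.
    - exists (a *: g); split; [|exact: leq_trans (size_scale_leq _ _) szg|by rewrite coefZ].
      by rewrite -mul_polyC; exact: (idealMl _ GI).
  move=> _ [g gS <-]; have szg : (size g <= size f)%N := Ssize _ _ gS.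
  exists (g * 'X^(size f - size g)); split.
  - by apply: (idealMr _ GI); exact: sub_ideal_gen.
  - have [->|g0] := eqVneq g 0; first by rewrite mul0r size_poly0.
    by rewrite size_mulXn // subnK.
  - have [g0|g0] := eqVneq g 0; first by rewrite g0 mul0r coef0 lead_coef0.
    rewrite coefMXn ifF; last by move: szg; rewrite -size_poly_gt0 in g0; lia.
    by rewrite lead_coefE /d; congr (g`_ _); move: szg; rewrite -size_poly_gt0 in g0; lia.
have [h [Sh szh hd]] := lowest _ lf.
have nfh : ~ ideal_gen [set` S k] (f - h).
  move=> fh; apply: nf; rewrite -/f -(subrK h f).
  exact: (idealD GI).
have Ifh : I (f - h).
  by apply: (idealB II If); exact: ideal_gen_sub (SI k) _ Sh.
have := fmin _ Ifh nfh; rewrite leqNgt => /negP; apply.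
rewrite -/f -[X in (_ < X)%N]prednK ?size_poly_gt0 // ltnS; apply/leq_sizeP => j.
rewrite -/d leq_eqVlt => /predU1P[<-|dj].
  by rewrite coefB hd lead_coefE subrr.
have fj : (size f <= j)%N by move: dj; rewrite /d -size_poly_gt0 in f0 *; lia.
by rewrite coefB !nth_default ?subrr // (leq_trans szh).
Qed.

End Hilbert.

(** * The Artin-Rees lemma for a principal ideal *)

Section ArtinRees.
Variable R : comNzRingType.
Implicit Types (J : set R).

(** The Rees algebra of J, as the polynomials whose coefficient of degree [i] lies
in the [i]-th power of J. *)
Definition rees J : set {poly R} := [set f | forall i, ideal_power J i f`_i].

Lemma rees_shiftM J k (f g : {poly R}) : rees J f ->
  (forall n, ideal_power J (n - k) g`_n) ->
  forall n, ideal_power J (n - k) (f * g)`_n.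
Proof.
move=> Jf Jg n; rewrite coefM; apply: ideal_sum => [|i _]; first exact: ideal_powerP.
have := ideal_powerM (Jf i) (Jg (n - i)%N); apply: ideal_power_le.
by have := ltn_ord i; lia.
Qed.

Lemma reesM J f g : rees J f -> rees J g -> rees J (f * g).
Proof.
move=> Jf Jg n; rewrite -[X in ideal_power J X]subn0.
by apply: (rees_shiftM Jf) => m; rewrite subn0.
Qed.

Lemma reesD J f g : rees J f -> rees J g -> rees J (f + g).
Proof.
move=> Jf Jg n; rewrite coefD.
by apply: idealD (Jf n) (Jg n); exact: ideal_powerP.
Qed.

(** [P] is an iterated polynomial ring with one variable for each [y] in [s], sent
to [y *: 'X]. When [s] generates J, the image of [psi] is the Rees algebra. *)
Lemma rees_noetherian J (s : seq R) : noetherian R -> [set` s] `<=` J ->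
  exists (P : comNzRingType) (psi : {rmorphism P -> {poly R}}),
    [/\ noetherian P, forall F, rees J (psi F),
      forall a, exists F, psi F = a%:P &
      forall y, y \in s -> exists F, psi F = y *: 'X].
Proof.
move=> noethR; elim: s => [|y s IH] sJ.
  exists R, (polyC : {rmorphism R -> {poly R}}); split=> // [a i|a]; last by exists a.
  case: i => // i; rewrite coefC; exact: (ideal0 (ideal_powerP J i.+1)).
have [|P [psi [noethP Jpsi psiC psiX]]] := IH.
  by move=> x xs; apply: sJ; rewrite /= inE xs orbT.
have cpsi : commr_rmorph psi (y *: 'X) by move=> ?; exact: mulrC.
exists {poly P}, (horner_morph cpsi); split=> [| |a|z].
- exact: hilbert_basis.
- have JyX : rees J (y *: 'X).
    move=> [|[|i]]; rewrite coefZ coefX ?mulr0 ?mulr1 /=.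
    + by [].
    + rewrite -[y]mulr1; apply: (@ideal_powerS _ J 0) => //.
      by apply: sJ; rewrite /= inE eqxx.
    + by exact: (ideal0 (ideal_powerP J i.+2)).
  elim/poly_ind => [|F c IHF].
    by rewrite rmorph0 => i; rewrite coef0; exact: (ideal0 (ideal_powerP J _)).
  rewrite rmorphD rmorphM [X in _ * X + _](horner_morphX cpsi).
  rewrite [X in _ + X](horner_morphC cpsi).
  by apply: reesD => //; exact: reesM.
- by have [F <-] := psiC a; exists F%:P; exact: (horner_morphC cpsi).
- rewrite inE => /predU1P[->|/psiX[F <-]]; first by exists 'X; exact: (horner_morphX cpsi).
  by exists F%:P; exact: (horner_morphC cpsi).
Qed.

(** Let [psi] map a Noetherian ring [P] onto the Rees algebra of J. The [F] in [P]
with [psi F] divisible by [c] form an ideal, the union of the ascending chain of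
ideals [B k], where [k] bounds the defect in degree of a quotient of [psi F] by
[c] from being in the Rees algebra. The chain stops at some [k], and the statement
is read off on [F] with [psi F = (c a) 'X^n]: the coefficient [g_n] of a quotient
of defect [k] lies in the power [n - k], and [b = a - g_n]. *)
Theorem artin_rees_principal J c : noetherian R -> is_ideal J -> exists k,
  forall n a, ideal_power J n (c * a) ->
    exists2 b, c * b = 0 & ideal_power J (n - k) (a - b).
Proof.
move=> noethR IJ; have [s Js] := noethR _ IJ.
have [|P [psi [noethP Jpsi psiC psiX]]] := @rees_noetherian J s noethR.
  by rewrite Js; exact: sub_ideal_gen.
have psi_monomial n a : ideal_power J n a -> exists F, psi F = a *: 'X^n.
  have IX m : is_ideal [set a | exists F, psi F = a *: 'X^m].
    split=> [|x y [F Fx] [G Gy]|x y [G Gy]] /=.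
    - by exists 0; rewrite rmorph0 scale0r.
    - by exists (F + G); rewrite rmorphD Fx Gy scalerDl.
    - have [F Fx] := psiC x.
      by exists (F * G); rewrite rmorphM Fx Gy mul_polyC scalerA.
  elim: n a => [|n IH] a; first by have [F Fa] := psiC a; exists F; rewrite Fa alg_polyC.
  move: a; apply: (ideal_gen_sub (IX n.+1)) => _ [x Jx [y /IH[G Gy] <-]] /=.
  have [F Fx] : exists F, psi F = x *: 'X^1.
    by move: x Jx; rewrite Js; apply: (ideal_gen_sub (IX 1)) => x /psiX.
  by exists (F * G); rewrite rmorphM Fx Gy -scalerAl -scalerAr scalerA -exprS.
pose B k : set P := [set F | exists2 g, psi F = c *: g &
  forall n, ideal_power J (n - k) g`_n].
have IB k : is_ideal (B k).
  split=> [|F G [f Ff Jf] [g Gg Jg]|F G [g Gg Jg]] /=.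
  - exists 0; first by rewrite rmorph0 scaler0.
    by move=> n; rewrite coef0; exact: (ideal0 (ideal_powerP J _)).
  - exists (f + g); first by rewrite rmorphD Ff Gg scalerDr.
    by move=> n; rewrite coefD; apply: idealD => //; exact: ideal_powerP.
  - exists (psi F * g); first by rewrite rmorphM Gg scalerAr.
    exact: rees_shiftM.
have [k Bk] : exists k, forall n, B n `<=` B k.
  apply: noetherian_chain => // m n mn F [g Fg Jg]; exists g => // i.
  by apply: ideal_power_le (Jg i); lia.
exists k => n a /psi_monomial[F Fa].
have [g Fg Jg] : B k F.
  (* a monomial of degree [n] has defect at most [n] *)
  apply: (Bk n); exists (a *: 'X^n); first by rewrite Fa scalerA.
  move=> m; rewrite coefZ coefXn; case: eqVneq => [->|_].
    by rewrite subnn.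
  by rewrite mulr0; exact: (ideal0 (ideal_powerP J _)).
exists (a - g`_n); last by rewrite opprB addrC subrK.
have := congr1 (fun f : {poly R} => f`_n) Fg.
rewrite Fa !coefZ coefXn eqxx mulr1 => e.
by rewrite mulrBr e subrr.
Qed.

End ArtinRees.

(** * Colon ideals in coherent rings *)

Section Colon.
Variable R : comPzRingType.
Implicit Types (I : set R).

Definition colon I x : set R := [set r | I (r * x)].

Lemma colonP I x : is_ideal I -> is_ideal (colon I x).
Proof.
move=> II; split=> [|a b Ia Ib|a b Ib]; rewrite /colon /= ?mul0r ?mulrDl -?mulrA.
- exact: ideal0.
- exact: idealD.
- exact: idealMl.
Qed.

(** [I : x] is the kernel of the map from R onto [(I + xR)/I] sending 1 to [x].
The presentation of [I + xR] at hand uses generators [g_j] of its own, written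
[g_j = u_j x] modulo I, while [x = w g]. A row [v] of coefficients then represents
[v u] times [x] modulo I, and the colon ideal is generated by the values of
[v u] at the rows of the relation matrix [A] and at rows [V l] representing the
generators of I, together with [1 - w u]. *)
Lemma coherent_colon I x : coherent R -> finitely_generated I ->
  finitely_generated (colon I x).
Proof.
move=> cohR [s Is]; have II : is_ideal I by rewrite Is; exact: ideal_genP.
have sI y : y \in s -> I y by rewrite Is; exact: (@sub_ideal_gen _ [set` s]).
have [|m [n [A [g [gK kerg]]]]] := cohR (ideal_gen [set` x :: s]); first by exists (x :: s).
have gen_x : ideal_gen [set` x :: s] x by apply: sub_ideal_gen; rewrite /= inE eqxx.
have [w _ wx] : range (fun v : 'rV_n => (v *m g) 0 0) x by rewrite gK.
have /choice[V Vs] (l : 'I_(size s)) : exists v : 'rV_n, (v *m g) 0 0 = s`_l.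
  have : ideal_gen [set` x :: s] s`_l.
    by apply: sub_ideal_gen; rewrite /= inE mem_nth ?orbT.
  by rewrite -gK => -[v _ ?]; exists v.
have /choice[u gu] (j : 'I_n) : exists u, I (g j 0 - u * x).
  have : ideal_gen [set` x :: s] (g j 0).
    by rewrite -gK; exists (delta_mx 0 j) => //; rewrite -rowE mxE.
  move: (g j 0); apply: ideal_gen_sub.
    split=> [|a b [t Ia] [v Ib]|a b [v Ib]] /=.
    - by exists 0; rewrite mul0r subr0; exact: ideal0.
    - by exists (t + v); rewrite mulrDl opprD addrACA; exact: idealD.
    - by exists (a * v); rewrite -mulrA -mulrBr; exact: idealMl.
  move=> y; rewrite /= inE => /predU1P[->|ys].
    by exists 1; rewrite mul1r subrr; exact: ideal0.
  by exists 0; rewrite mul0r subr0; exact: sI.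
pose U : 'cV[R]_n := \col_j u j.
have gUx (v : 'rV_n) : I ((v *m g) 0 0 - (v *m U) 0 0 * x).
  rewrite !mxE big_distrl -sumrB; apply: ideal_sum => // j _.
  by rewrite /= !mxE -mulrA -mulrBr; exact: idealMl.
pose gens := (1 - (w *m U) 0 0) ::
  [seq (A *m U) i 0 | i <- enum 'I_m] ++ [seq (V l *m U) 0 0 | l <- enum 'I_(size s)].
exists gens; have II' := colonP x II; have GI := ideal_genP [set` gens].
have gensP r : r \in gens -> ideal_gen [set` gens] r by exact: (@sub_ideal_gen _ [set` gens]).
apply/seteqP; split=> [r Ir|].
  have : ideal_gen [set` s] (r * x) by rewrite -Is.
  move=> /ideal_gen_seqP[t rx].
  have /kerg[z rz] : (r *: w - \sum_l t l *: V l) *m g = 0.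
    apply/matrixP => i j; rewrite !ord1 mulmxBl -scalemxAl mulmx_suml mxE [X in X + _]mxE.
    rewrite wx rx [X in _ + X]mxE summxE [RHS]mxE; apply/eqP; rewrite subr_eq0; apply/eqP.
    by apply: eq_bigr => l _; rewrite -scalemxAl mxE Vs.
  have -> : r = r * (1 - (w *m U) 0 0) + ((z *m (A *m U)) 0 0
     + \sum_l t l * (V l *m U) 0 0).
    have := congr1 (fun M : 'rV_n => (M *m U) 0 0) rz.
    rewrite mulmxBl -scalemxAl mulmx_suml -mulmxA mxE [X in X + _]mxE.
    rewrite [X in _ + X]mxE summxE => e.
    rewrite -e (eq_bigr (fun l => t l * (V l *m U) 0 0)).
      by rewrite subrK mulrBr mulr1 subrK.
    by move=> l _; rewrite -scalemxAl mxE.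
  apply: (idealD GI); first by apply: (idealMl _ GI); apply: gensP; rewrite inE eqxx.
  apply: (idealD GI).
    rewrite mxE; apply: (ideal_sum _ GI) => i _; apply: (idealMl _ GI); apply: gensP.
    rewrite inE mem_cat; apply/orP; right; apply/orP; left.
    by apply: map_f; rewrite mem_enum.
  apply: (ideal_sum _ GI) => l _; apply: (idealMl _ GI); apply: gensP.
  rewrite inE mem_cat; apply/orP; right; apply/orP; right.
  by apply/mapP; exists l => //; rewrite mem_enum.
apply: (ideal_gen_sub II') => r; rewrite /= inE mem_cat /colon /= => /or3P[/eqP->||].
- by rewrite mulrBl mul1r -[X in X - _]wx; exact: gUx.
- case/mapP => i _ ->; have := gUx (row i A).
  have -> : row i A *m g = 0 by apply/kerg; exists (delta_mx 0 i); rewrite -rowE.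
  rewrite -row_mul [X in X - _]mxE [X in _ - X * _]mxE sub0r => /(idealN II).
  by rewrite opprK.
- case/mapP => l _ ->; have := gUx (V l); rewrite Vs => IV.
  have Isl : I s`_l by apply: sI; exact: mem_nth.
  by have := idealB II Isl IV; rewrite opprB addrC subrK.
Qed.

End Colon.

(** * Minimal primes of reduced rings *)

Section MinimalPrimes.
Variable R : comPzRingType.

Lemma off_minimal_primes1 : off_minimal_primes (1 : R).
Proof. by case=> P [[_ P1 _] _]. Qed.

(** Zorn's lemma for multiplicative sets avoiding 0. To include the empty chain,
it is applied to the sets [A] such that [A] becomes such a multiplicative set
once the powers of [x] are added. If the maximal one, W, does not contain [a],
then the products [w * a ^+ n] form a larger multiplicative set, which must
therefore contain 0. *)
Lemma maximal_mult_set (x : R) : (forall n, x ^+ n <> 0) ->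
  exists W : set R, [/\ W 1, W x, forall a b, W a -> W b -> W (a * b), ~ W 0 &
    forall a, ~ W a -> exists n w, W w /\ w * a ^+ n = 0].
Proof.
move=> xn0; pose hat (A : set R) := A `|` range (fun n => x ^+ n).
pose good A := ~ hat A 0 /\ forall a b, hat A a -> hat A b -> hat A (a * b).
have hat_pow A n : hat A (x ^+ n) by right; exists n.
have [F Fgood Ftot|A [[A0 AM] Amax]] := @Zorn_bigcup R good.
  split=> [[[A FA A0]|[n _]]|a b]; last 2 first.
  - exact: xn0.
  - case=> [[A FA Aa]|[n _ <-]] [[B FB Bb]|[m _ <-]].
    + have [AB|BA] := Ftot _ _ FA FB.
      * have [_ /(_ a b)[||H|H]] := Fgood _ FB; [left; exact: AB|by left|by left; exists B|by right].
      * have [_ /(_ a b)[||H|H]] := Fgood _ FA; [by left|left; exact: BA|by left; exists A|by right].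
    + by have [_ /(_ a (x ^+ m))[||H|H]] := Fgood _ FA; [left|exact: hat_pow|left; exists A|right].
    + by have [_ /(_ (x ^+ n) b)[||H|H]] := Fgood _ FB; [exact: hat_pow|left|left; exists B|right].
    + by rewrite -exprD; exact: hat_pow.
  - by have [+ _] := Fgood _ FA; apply; left.
exists (hat A); split=> //; [exact: (hat_pow A 0%N)|exact: (hat_pow A 1%N)|].
move=> a nAa; apply: contrapT => nw.
pose A' : set R := [set z | exists n w, hat A w /\ z = w * a ^+ n].
have AA' : hat A `<=` A' by move=> w Aw; exists 0%N, w; rewrite mulr1.
have A'E : hat A' = A'.
  by apply/seteqP; split=> z; [case=> // -[n _ <-]; exact: AA'|left].
apply: (Amax A'); last first.
  rewrite /good A'E; split=> [[n [w [Aw e]]]|_ _ [n [w [Aw ->]]] [m [v [Av ->]]]].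
    by apply: nw; exists n, w.
  exists (n + m)%N, (w * v); split; first exact: AM.
  by rewrite exprD mulrACA.
split=> [z Az|A'A]; first by apply: AA'; left.
apply: nAa; left; apply: A'A; exists 1%N, 1; rewrite mul1r; split=> //.
exact: (hat_pow A 0%N).
Qed.

(** If [a] is nonzero in a reduced ring, the complement of a maximal multiplicative
set W containing [a] consists of the elements annihilated by an element of W,
hence is a minimal prime; it contains [c], because [c * a = 0]. *)
Lemma off_minimal_primes_regular (c a : R) : reduced R ->
  off_minimal_primes c -> c * a = 0 -> a = 0.
Proof.
move=> redR cP ca; apply: contrapT => a0.
have [|W [W1 Wa WM W0 Wmax]] := @maximal_mult_set a.
  by move=> n /redR.
have Wann b : ~ W b -> exists2 w, W w & w * b = 0.
  move=> /Wmax[n [w [Ww e]]]; exists w => //; apply: (redR _ n.+1).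
  by rewrite exprMn exprS exprSr mulrACA e mul0r.
apply: cP; exists (~` W); last by move=> Wc; apply: W0; rewrite -ca; exact: WM.
have annW w b : W w -> w * b = 0 -> ~ W b.
  by move=> Ww e Wb; apply: W0; rewrite -e; exact: WM.
split.
  split; [split=> //|by apply|].
  - move=> b d /Wann[v Wv vb] /Wann[w Ww wd]; apply: (annW (v * w)); first exact: WM.
    by rewrite mulrDr mulrAC vb mul0r -mulrA wd mulr0 addr0.
  - by move=> b d /Wann[v Wv vd]; apply: (annW v) => //; rewrite mulrCA vd mulr0.
  - move=> b d Wbd; apply: contrapT => /not_orP[/contrapT Wb /contrapT Wd].
    by apply: Wbd; exact: WM.
move=> Q [[Q0 _ _] _ QM] QP; apply/seteqP; split=> // b /Wann[w Ww wb].
by have [|/QP|] := QM w b; first by rewrite wb.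
Qed.

End MinimalPrimes.

(** * Descent along the perfect closure *)

Lemma mult_setX (R : comPzRingType) (W : mult_set R) w n :
  mult_set_carrier W w -> mult_set_carrier W (w ^+ n).
Proof.
move=> Ww; elim: n => [|n IH]; first exact: mult_set1.
by rewrite exprS; exact: mult_setM.
Qed.

Section PerfectClosure.
Variables (R : comNzRingType) (p : nat) (pcharRp : p \in [pchar R]).
Local Notation S := (perfect_closure pcharRp).
Local Notation F := (pFrobenius_aut pcharRp).
Local Notation iota := (to_perfect_closure pcharRp).

Lemma char_gt0 : (0 < p)%N. Proof. exact/prime_gt0/(pcharf_prime pcharRp). Qed.

Lemma iter_Frobenius n a : iter n F a = a ^+ (p ^ n).
Proof. by elim: n => //= n ->; rewrite pFrobenius_autE -exprM -expnSr. Qed.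

(** The class of [a] in the copy of R of index [e] is the [p^e]-th root of [a]. *)
Definition frobenius_root (e : nat) (a : R) : S := \pi_(IterLimit.type F) (e, a).

Lemma frobenius_root_is_zmod_morphism e : zmod_morphism (frobenius_root e).
Proof.
move=> a b; rewrite /frobenius_root -[X in _ = _ + X]IterLimit.pi_opp -[RHS]IterLimit.pi_add.
by apply: IterLimit.germ_eq; rewrite /= -IterLimit.iterA -iterD.
Qed.

Lemma frobenius_root_is_monoid_morphism e : monoid_morphism (frobenius_root e).
Proof.
split=> [|a b].
  rewrite /frobenius_root -[RHS]/(IterLimit.one _) !piE.
  by apply: IterLimit.germ_eq; rewrite /= IterLimit.iter1.
rewrite /frobenius_root -[RHS]IterLimit.pi_mul.
by apply: IterLimit.germ_eq; rewrite /= -IterLimit.iterM -iterD.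
Qed.

HB.instance Definition _ e :=
  GRing.isZmodMorphism.Build R S (frobenius_root e) (@frobenius_root_is_zmod_morphism e).
HB.instance Definition _ e :=
  GRing.isMonoidMorphism.Build R S (frobenius_root e) (@frobenius_root_is_monoid_morphism e).

Lemma frobenius_root_shift e k a : frobenius_root (e + k) (a ^+ (p ^ k)) = frobenius_root e a.
Proof. by apply: IterLimit.germ_eq; rewrite /= !iter_Frobenius -!exprM -!expnD addnC. Qed.

Lemma frobenius_rootX e a : frobenius_root e a ^+ (p ^ e) = iota a.
Proof. by rewrite -rmorphXn; exact: (frobenius_root_shift 0 e a). Qed.

Lemma frobenius_rootP (z : S) : exists e a, z = frobenius_root e a.
Proof. by elim/quotW: z => -[e a]; exists e, a. Qed.

Lemma to_perfect_closure_inj : reduced R -> injective iota.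
Proof.
move=> redR a b /eqmodP/IterLimit.equivP[k] /=.
rewrite addn0 !iter_Frobenius => e; apply/eqP; rewrite -subr_eq0; apply/eqP.
apply: (redR _ (p ^ k)%N); rewrite -iter_Frobenius IterLimit.iterA IterLimit.iterN.
by rewrite !iter_Frobenius e subrr.
Qed.

(** Both elements come from one copy of R, where the Frobenius is additive. *)
Lemma perfect_closureXD n (y z : S) :
  (y + z) ^+ (p ^ n) = y ^+ (p ^ n) + z ^+ (p ^ n).
Proof.
have [d [a ->]] := frobenius_rootP y; have [e [b ->]] := frobenius_rootP z.
rewrite -(frobenius_root_shift d e) -(frobenius_root_shift e d) [(e + d)%N]addnC.
rewrite -rmorphD -!rmorphXn -rmorphD; congr frobenius_root.
by rewrite -!iter_Frobenius IterLimit.iterA.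
Qed.

(** S is purely inseparable over the image of R. *)
Lemma power_in_base (z : S) : exists M0, forall M, (M0 <= M)%N ->
  exists a, z ^+ (p ^ M) = iota a.
Proof.
have [e [a ->]] := frobenius_rootP z; exists e => M eM; exists (a ^+ (p ^ (M - e))).
by rewrite rmorphXn -(frobenius_rootX e a) -exprM -expnD subnKC.
Qed.

(** In [d = \sum_i r_i a_i], a large power of [p] puts all the coefficients [r_i] in R
while the Frobenius distributes over the sum. *)
Lemma extended_power (I : set R) (d : S) : ideal_gen (iota @` I) d ->
  exists M0, forall M, (M0 <= M)%N ->
    exists2 a, bracket_power I (p ^ M) a & d ^+ (p ^ M) = iota a.
Proof.
have BI q : is_ideal (bracket_power I q) := ideal_genP _.
move: d; apply: ideal_gen_sub.
  split=> [|y z [M Iy] [N Iz]|r y [M Iy]] /=.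
  - exists 0%N => M _; exists 0; first exact: ideal0.
    by rewrite rmorph0 expr0n expn_eq0 eqn0Ngt char_gt0.
  - exists (maxn M N) => L; rewrite geq_max => /andP[/Iy[a Ia ea] /Iz[b Ib eb]].
    by exists (a + b); [exact: (idealD (BI _))|rewrite perfect_closureXD ea eb rmorphD].
  - have [N rN] := power_in_base r.
    exists (maxn M N) => L; rewrite geq_max => /andP[/Iy[a Ia ea] /rN[b eb]].
    by exists (b * a); [exact: (idealMl _ (BI _))|rewrite exprMn ea eb rmorphM].
move=> _ [a Ia <-]; exists 0%N => M _; exists (a ^+ (p ^ M)); last by rewrite rmorphXn.
by apply: sub_ideal_gen; exists a.
Qed.

Lemma frobenius_root_bracket_power (I : set R) e a : bracket_power I (p ^ e) a ->
  ideal_gen (iota @` I) (frobenius_root e a).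
Proof.
have GI := ideal_genP (iota @` I).
move: a; apply: ideal_gen_sub.
  split=> [|a b Ia Ib|a b Ib] /=; rewrite ?rmorph0 ?rmorphD ?rmorphM.
  - exact: (ideal0 GI).
  - exact: (idealD GI).
  - exact: (idealMl _ GI).
move=> _ [b Ib <-]; rewrite /= rmorphXn frobenius_rootX.
by apply: sub_ideal_gen; exists b.
Qed.

Lemma frobenius_closureP (I : set R) x : reduced R ->
  frobenius_closure pcharRp I x ->
  exists e0, forall e, (e0 <= e)%N -> bracket_power I (p ^ e) (x ^+ (p ^ e)).
Proof.
move=> redR /extended_power[e0 Ie]; exists e0 => e /Ie[a Ia].
by rewrite -rmorphXn => /(to_perfect_closure_inj redR) ->.
Qed.

Lemma finitely_generated_extension (I : set R) : finitely_generated I ->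
  finitely_generated (ideal_gen (iota @` I)).
Proof.
move=> [s ->]; exists (map iota s); apply/seteqP; split; apply: ideal_gen_sub;
  do ?exact: ideal_genP.
- move=> _ [a Ia <-]; move: a Ia; apply: ideal_gen_sub.
    have GI := ideal_genP [set` map iota s].
    split=> [|a b Ia Ib|a b Ib] /=; rewrite ?rmorph0 ?rmorphD ?rmorphM.
    + exact: (ideal0 GI).
    + exact: (idealD GI).
    + exact: (idealMl _ GI).
  by move=> a sa; apply: sub_ideal_gen; exact: map_f.
- move=> _ /mapP[a sa ->]; apply: sub_ideal_gen; exists a => //.
  exact: sub_ideal_gen.
Qed.

(** The generators of J have a common level: they are [p^N]-th roots of elements
of R. Then [J0] is the ideal of the [a] with [a^{1/p^N}] in J. *)
Lemma fg_ideal_descent (J : set S) : finitely_generated J ->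
  exists N (J0 : set R), [/\ is_ideal J0,
    forall a, J0 a -> J (iota a) &
    forall d, J d -> ideal_gen (iota @` J0) (d ^+ (p ^ N))].
Proof.
move=> [s Js]; have IJ : is_ideal J by rewrite Js; exact: ideal_genP.
have [|z zs|N sN] := @uniform_bound _ s (fun n (z : S) => exists a, z = frobenius_root n a).
- move=> k l z kl [a ->]; exists (a ^+ (p ^ (l - k))).
  by rewrite -{1}(subnKC kl) frobenius_root_shift.
- exact: frobenius_rootP.
exists N, [set a | J (frobenius_root N a)]; split=> [|a Ja|].
- split=> [|a b Ia Ib|a b Ib] /=; rewrite ?rmorph0 ?rmorphD ?rmorphM.
  + exact: (ideal0 IJ).
  + exact: (idealD IJ).
  + exact: (idealMl _ IJ).
- rewrite -(frobenius_rootX N) -[(p ^ N)%N]prednK ?expn_gt0 ?char_gt0 // exprSr.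
  exact: (idealMl _ IJ).
have GJ := ideal_genP (iota @` [set a | J (frobenius_root N a)]).
move=> d; rewrite {1}Js; move: d; apply: ideal_gen_sub.
  split=> [|a b Ia Ib|a b Ib] /=.
  - rewrite expr0n expn_eq0 eqn0Ngt char_gt0; exact: (ideal0 GJ).
  - by rewrite perfect_closureXD; exact: (idealD GJ).
  - by rewrite exprMn; exact: (idealMl _ GJ).
move=> z zs; have [a za] := sN _ zs; apply: sub_ideal_gen.
exists a; last by rewrite za frobenius_rootX.
by rewrite /= -za Js; exact: sub_ideal_gen.
Qed.

(** The argument runs on [(w c)^{1/q}] in place of [c^{1/q}], where [w] may vary
with [q]. Only the powers of [c] are cancelled; the power of [w] stays, and the
outcome is that [v w^Q] lies in [J0] for some [v] in W, instead of 1. *)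
Theorem frobenius_closure_of_tight (W : mult_set R) (I : set R) (c x : R) (e0 : nat) :
  reduced R -> F_coherent pcharRp -> is_ideal I ->
  (forall a, c * a = 0 -> exists2 w, mult_set_carrier W w & w * a = 0) ->
  (forall e, (e0 <= e)%N ->
     exists2 w, mult_set_carrier W w & bracket_power I (p ^ e) (w * c * x ^+ (p ^ e))) ->
  exists2 w, mult_set_carrier W w & frobenius_closure pcharRp I (w * x).
Proof.
move=> redR [noethR cohS] II creg tight.
pose J := colon (ideal_gen (iota @` I)) (iota x).
have Jfg : finitely_generated J by apply: coherent_colon => //; exact/finitely_generated_extension/noethR.
have [N [J0 [IJ0 J0J JJ0]]] := fg_ideal_descent Jfg.
have [k AR] := artin_rees_principal c noethR IJ0.
(* [(w c)^Q] will lie in the power [Q * p ^ (e - N)] of [J0], while cancelling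
   [c^Q] costs [Q * k]; [k <= e - N] ensures that [k < p ^ (e - N)]. *)
pose e := maxn e0 (N + k).
have [w Ww Iw] := tight e (leq_maxl _ _).
have Jd : J (frobenius_root e (w * c)).
  rewrite /J /colon /= -[iota x]/(frobenius_root 0 x) -(frobenius_root_shift 0 e) -rmorphM.
  exact: frobenius_root_bracket_power.
have [M0 dM] := extended_power (JJ0 _ Jd).
pose M := maxn M0 e; have eM : (e <= M)%N := leq_maxr _ _.
have [b J0b db] := dM M (leq_maxl _ _).
(* [(c^{1/p^e})^{p^(N+M)} = c^Q] *)
pose Q := (p ^ (N + M - e))%N.
have J0c : ideal_power J0 (p ^ M) ((w * c) ^+ Q).
  suff -> : (w * c) ^+ Q = b by exact: bracket_power_sub.
  apply: (to_perfect_closure_inj redR); rewrite -db rmorphXn -(frobenius_rootX e) -!exprM.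
  by congr (_ ^+ _); rewrite -!expnD subnKC //; lia.
(* each factor [c] cancelled costs [k] in the exponent of [J0] *)
have cancel n m a : ideal_power J0 n (a * c ^+ m) ->
    exists2 v, mult_set_carrier W v & ideal_power J0 (n - m * k) (v * a).
  elim: m n a => [|m IH] n a.
    by rewrite mulr1 => Ja; exists 1; [exact: mult_set1|rewrite mul1r subn0].
  rewrite exprS mulrCA => /AR[u /creg[v Wv vu] Ju].
  have /IH[v' Wv' J'] : ideal_power J0 (n - k) (v * a * c ^+ m).
    have := idealMl v (ideal_powerP _ _) Ju.
    by rewrite mulrBr vu subr0 mulrA.
  exists (v' * v); first exact: mult_setM.
  by rewrite mulSn subnDA -mulrA.
move: J0c; rewrite exprMn => /cancel[v Wv].
have Qk : (0 < p ^ M - Q * k)%N.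
  rewrite subn_gt0.
  have -> : (p ^ M = Q * p ^ (e - N))%N.
    rewrite /Q -expnD; congr (p ^ _)%N; lia.
  rewrite ltn_pmul2l ?expn_gt0 ?char_gt0 //.
  apply: leq_trans (ltn_expl k (prime_gt1 (pcharf_prime pcharRp))) _.
  by rewrite leq_exp2l ?prime_gt1 ?(pcharf_prime pcharRp) //; lia.
move=> /(ideal_power_sub IJ0 Qk) J0w.
exists (v * w ^+ Q); last by rewrite /frobenius_closure /= rmorphM; exact: J0J.
by apply: mult_setM => //; exact: mult_setX.
Qed.

End PerfectClosure.

(** * Ideals of localizations *)

Section Localization.
Variables (R : comPzRingType) (W : mult_set R).
Local Notation D := (localization W).
Local Notation inj := (Localization.inj W).
Implicit Types (I : set R) (u : D).

Lemma localization_inj_eq0 a : inj a = 0 <-> exists2 w, mult_set_carrier W w & w * a = 0.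
Proof.
have -> : (0 : D) = inj 0 by rewrite rmorph0.
split=> [/eqmodP/Localization.equivP[w Ww]|[w Ww wa]].
  by rewrite /= Localization.den1E !mulr1 mulr0; exists w.
apply/eqmodP/Localization.equivP; exists w => //=.
by rewrite Localization.den1E !mulr1 mulr0.
Qed.

Lemma localizationP u : exists a w (v : D),
  [/\ mult_set_carrier W w, u * inj w = inj a, inj w * v = 1 & u = inj a * v].
Proof.
elim/quotW: u => -[a s].
pose v : D := \pi_(Localization.type W) (1, s).
have wv : inj (Localization.den s) * v = 1.
  rewrite -[RHS]/(Localization.one W) -[LHS]Localization.pi_mul !piE.
  by apply: Localization.frac_eq; rewrite /= ?Localization.denE; ring.
have uw : \pi_(Localization.type W) (a, s) * inj (Localization.den s) = inj a.
  rewrite -[LHS]Localization.pi_mul.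
  by apply: Localization.frac_eq; rewrite /= ?Localization.denE; ring.
exists a, (Localization.den s), v; split=> //; first exact: Localization.denP.
by rewrite -uw -mulrA wv mulr1.
Qed.

Lemma localization_unit_inj w : mult_set_carrier W w -> exists v, inj w * v = 1.
Proof.
move=> Ww; exists (\pi_(Localization.type W) (1, Localization.mkden Ww)).
rewrite -[RHS]/(Localization.one W) -[LHS]Localization.pi_mul !piE.
by apply: Localization.frac_eq; rewrite /= ?Localization.denE /Localization.den /=; ring.
Qed.

Lemma localization_reduced : reduced R -> reduced D.
Proof.
move=> redR u n un; have [a [w [v [Ww uw wv ->]]]] := localizationP u.
have /localization_inj_eq0[t Wt ta] : inj (a ^+ n) = 0.
  by rewrite rmorphXn /= -uw exprMn un mul0r.
suff -> : inj a = 0 by rewrite mul0r.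
apply/localization_inj_eq0; exists t => //; apply: (redR _ n.+1).
by rewrite exprMn exprS exprSr mulrACA ta mul0r.
Qed.

Lemma extended_ideal I u : is_ideal I -> ideal_gen (inj @` I) u ->
  exists a w, [/\ mult_set_carrier W w, I a & u * inj w = inj a].
Proof.
move=> II; move: u; apply: ideal_gen_sub.
  split=> [|u1 u2 [a [v [Wv Ia ua]]] [b [w [Ww Ib ub]]]|u1 u2 [b [w [Ww Ib ub]]]] /=.
  - exists 0, 1; split; [exact: mult_set1|exact: ideal0|by rewrite mul0r rmorph0].
  - exists (a * w + b * v), (v * w); split; first exact: mult_setM.
      by apply: idealD => //; exact: idealMr.
    by rewrite rmorphD !rmorphM /= -ua -ub; ring.
  - have [a [v [_ [Wv ua _ _]]]] := localizationP u1.
    exists (a * b), (v * w); split; [exact: mult_setM|exact: idealMl|].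
    by rewrite !rmorphM /= -ua -ub; ring.
move=> _ [a Ia <-]; exists a, 1; split=> //; first exact: mult_set1.
by rewrite rmorph1 mulr1.
Qed.

Lemma extended_idealP I a : is_ideal I ->
  ideal_gen (inj @` I) (inj a) <-> exists2 w, mult_set_carrier W w & I (w * a).
Proof.
move=> II; split=> [/(extended_ideal II)[b [w [Ww Ib /eqP]]]|[w Ww Iwa]].
  rewrite -subr_eq0 -rmorphM -rmorphB => /eqP/localization_inj_eq0[v Wv /eqP].
  rewrite mulrBr subr_eq0 => /eqP e; exists (v * w); first exact: mult_setM.
  by rewrite -mulrA [w * a]mulrC e; exact: idealMl.
have [v wv] := localization_unit_inj Ww.
rewrite -[inj a]mul1r -wv mulrAC -rmorphM.
by apply: (idealMr _ (ideal_genP _)); apply: sub_ideal_gen; exists (w * a).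
Qed.

Definition contraction (B : set D) : set R := inj @^-1` B.

Lemma contractionP (B : set D) : is_ideal B -> is_ideal (contraction B).
Proof.
move=> IB; split=> [|a b Ia Ib|a b Ib]; rewrite /contraction /= ?rmorph0 ?rmorphD ?rmorphM.
- exact: (ideal0 IB).
- exact: (idealD IB).
- exact: (idealMl _ IB).
Qed.

Lemma localization_ideal_fraction (B : set D) u a w :
  is_ideal B -> mult_set_carrier W w -> u * inj w = inj a -> B u <-> contraction B a.
Proof.
move=> IB Ww uw; rewrite /contraction /= -uw; split=> [Bu|Buw]; first exact: (idealMr _ IB).
have [v wv] := localization_unit_inj Ww.
by rewrite -[u]mulr1 -wv mulrA; exact: (idealMr _ IB).
Qed.

Lemma localization_noetherian : noetherian R -> noetherian D.
Proof.
move=> noethR B IB; have [s Bs] := noethR _ (contractionP IB).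
exists (map inj s); have GI := ideal_genP [set` map inj s].
apply/seteqP; split=> [u Bu|].
  have [a [w [v [Ww uw wv e]]]] := localizationP u.
  have /(localization_ideal_fraction IB Ww uw) Ba := Bu.
  rewrite e; apply: (idealMr _ GI); move: a Ba {uw e}; rewrite Bs.
  apply: (ideal_gen_sub (contractionP GI)).
  by move=> a sa; apply: sub_ideal_gen; exact: map_f.
apply: (ideal_gen_sub IB) => _ /mapP[a sa ->].
suff : contraction B a by [].
by rewrite Bs; exact: sub_ideal_gen.
Qed.

(** Every element of B is a unit times the image of an element of its contraction,
so the bracket power of B is extended from the one of the contraction. *)
Lemma bracket_power_contraction (B : set D) q a : is_ideal B ->
  bracket_power B q (inj a) ->
  exists2 w, mult_set_carrier W w & bracket_power (contraction B) q (w * a).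
Proof.
move=> IB Ba; apply/extended_idealP; first exact: ideal_genP.
move: (inj a) Ba; apply: ideal_gen_sub; first exact: ideal_genP.
move=> _ [u Bu <-]; have [b [w [v [Ww uw wv e]]]] := localizationP u.
rewrite e exprMn -rmorphXn; apply: (idealMr _ (ideal_genP _)).
apply: sub_ideal_gen; exists (b ^+ q) => //; apply: sub_ideal_gen; exists b => //.
by apply/(localization_ideal_fraction IB Ww uw).
Qed.

(** The multiplier can be taken to be 1, which stays outside the minimal primes
of every localization. *)
Lemma tight_closure_inj p I x : is_ideal I ->
  (exists e0, forall e, (e0 <= e)%N -> bracket_power I (p ^ e) (x ^+ (p ^ e))) ->
  tight_closure p (ideal_gen (inj @` I)) (inj x).
Proof.
move=> II [e0 Ix]; exists 1; first exact: off_minimal_primes1.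
exists e0 => e /Ix; rewrite mul1r -rmorphXn; set q := (p ^ e)%N.
have GI := ideal_genP [set y ^+ q | y in ideal_gen (inj @` I)].
move: (x ^+ q); apply: (ideal_gen_sub (contractionP GI)).
move=> _ [a Ia <-]; rewrite /contraction /= rmorphXn; apply: sub_ideal_gen.
by exists (inj a) => //; apply: sub_ideal_gen; exists a.
Qed.

End Localization.

(** * The comparison of closures *)

Lemma trivial_mult_set_closed (R : comPzRingType) (x y : R) :
  [set 1] x -> [set 1] y -> [set 1] (x * y).
Proof. by move=> -> ->; rewrite mulr1. Qed.

Definition trivial_mult_set (R : comPzRingType) : mult_set R :=
  MultSet (erefl : [set 1] 1) (@trivial_mult_set_closed R).

Theorem proposition3p11 (p : nat) (R : comNzRingType)
    (pcharRp : p \in [pchar R]%R)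
    (R_reduced : reduced R) (R_noetherian : noetherian R)
    (R_F_coherent : F_coherent pcharRp) :
  (forall I : set R, is_ideal I ->
     frobenius_closure pcharRp I = tight_closure p I) /\
  (F_pure pcharRp <-> F_regular p R).
Proof.
have sub_tight (R' : comPzRingType) (I : set R') : is_ideal I -> I `<=` tight_closure p I.
  move=> II x Ix; exists 1; first exact: off_minimal_primes1.
  by exists 0%N => e _; rewrite mul1r; apply: sub_ideal_gen; exists x.
split=> [I II|].
  apply/seteqP; split=> x.
    move=> /(frobenius_closureP R_reduced)[e0 Ix]; exists 1; first exact: off_minimal_primes1.
    by exists e0 => e /Ix; rewrite mul1r.
  case=> c cP [e0 Ix].
  have [||w ->] := frobenius_closure_of_tight (W := trivial_mult_set R)
    (c := c) (x := x) (e0 := e0) R_reduced R_F_coherent II.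
  - by move=> a /(off_minimal_primes_regular R_reduced cP) ->; exists 1; rewrite ?mulr0.
  - by move=> e /Ix; exists 1; rewrite ?mul1r.
  - by rewrite mul1r.
split=> [[_ pureR]|[_ regR]]; split=> //.
  move=> W; split; first exact: localization_noetherian.
  move=> B IB; apply/seteqP; split; last exact: sub_tight.
  move=> u [c' cP [e0 Bu]].
  have [x [w [v [Ww ux wv ue]]]] := localizationP u.
  have [c [w' [v' [Ww' cc wv' ce]]]] := localizationP c'.
  apply/(localization_ideal_fraction IB Ww ux).
  have IC := contractionP IB.
  have [||t Wt] := frobenius_closure_of_tight (W := W)
    (c := c) (x := x) (e0 := e0) R_reduced R_F_coherent IC.
  - move=> a ca; apply/localization_inj_eq0.
    apply: (off_minimal_primes_regular (localization_reduced R_reduced) cP).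
    by rewrite ce mulrAC -rmorphM ca rmorph0 mul0r.
  - move=> e /Bu Bcu.
    have [|t Wt] := @bracket_power_contraction _ W B (p ^ e) (c * x ^+ (p ^ e)) IB.
      rewrite rmorphM rmorphXn /= -ux -cc exprMn mulrACA.
      by apply: (idealMr _ (ideal_genP _)).
    by exists t => //; rewrite -mulrA.
  (* purity turns membership in the Frobenius closure into [t * x] in the
     contraction of B, with [t] a unit of the localization *)
  rewrite pureR // => Ctx.
  have [s ts] := localization_unit_inj Wt.
  rewrite /contraction /= -[Localization.inj W x]mul1r -ts mulrAC -rmorphM.
  exact: (idealMr _ IB).
move=> I II; apply/seteqP; split=> x.
  move=> /(frobenius_closureP R_reduced)/(tight_closure_inj (trivial_mult_set R) II).
  have [_ ->] := regR (trivial_mult_set R); last exact: ideal_genP.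
  by move=> /extended_idealP[//|w ->]; rewrite mul1r.
by move=> Ix; apply: sub_ideal_gen; exists x.
Qed.
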